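(* If $R$ is a weakly $2$-primal periodic ring and $G$ is a locally finite group, then the group ring $RG$ is periodic.
   Context: All rings are associative with identity (not necessarily commutative). A ring $R$ is periodic if for every $x\in R$ there exist distinct positive integers $m\neq n$ with $x^m=x^n$. $\mathrm{Nil}(R)$ denotes the set of nilpotent elements of $R$, and the Levitzki radical $L\text{-}rad(R)$ is the largest locally nilpotent two-sided ideal of $R$ (an ideal is locally nilpotent if for every finite subset of it there is a natural number $N$ such that every product of $N$ elements from this subset is zero). $R$ is weakly $2$-primal if $\mathrm{Nil}(R)=L\text{-}rad(R)$. A group is locally finite if each of its finitely generated subgroups is finite. *)

(* Defs.v *)
From HB Require Import structures.
From mathcomp Require Import all_boot all_algebra finmap.
From mathcomp Require Import monalg.

Set Implicit Arguments.
Unset Strict Implicit.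
Unset Printing Implicit Defensive.

Import GRing.Theory.

Local Open Scope fset_scope.
Local Open Scope ring_scope.

(* Rings are [pzRingType]s, so that the zero ring is allowed. *)
Section Rings.

Definition periodic (R : pzRingType) : Prop :=
  forall x : R, exists m n : nat,
    [/\ (0 < m)%N, (0 < n)%N, m <> n & x ^+ m = x ^+ n].

Definition nilpotent_elt (R : pzRingType) (x : R) : Prop :=
  exists n : nat, x ^+ n = 0.

Record two_sided_ideal (R : pzRingType) (I : R -> Prop) : Prop :=
  TwoSidedIdeal {
    ideal0 : I 0;
    idealB : forall x y, I x -> I y -> I (x - y);
    idealMl : forall a x, I x -> I (a * x);
    idealMr : forall a x, I x -> I (x * a)
  }.

(* The finite subset is given by an enumeration [s]; a product of [N] elements
   of it, possibly with repetitions, is given by its list [t] of factors. *)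
Definition locally_nilpotent (R : pzRingType) (I : R -> Prop) : Prop :=
  forall s : seq R, (forall x, x \in s -> I x) ->
  exists2 N : nat, (0 < N)%N &
    forall t : seq R, size t = N -> {subset t <= s} -> \prod_(x <- t) x = 0.

Definition is_Levitzki_radical (R : pzRingType) (L : R -> Prop) : Prop :=
  [/\ two_sided_ideal L, locally_nilpotent L &
      forall I : R -> Prop, two_sided_ideal I -> locally_nilpotent I ->
        forall x, I x -> L x].

Definition weakly_2primal (R : pzRingType) : Prop :=
  exists L : R -> Prop,
    is_Levitzki_radical L /\ (forall x, nilpotent_elt x <-> L x).

End Rings.

Section Groups.
Local Open Scope group_scope.

Record is_subgroup (G : groupType) (H : G -> Prop) : Prop := IsSubgroup {
  subgroup1 : H 1;
  subgroupM : forall x y, H x -> H y -> H (x * y);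
  subgroupV : forall x, H x -> H x^-1
}.

Definition generated_subgroup (G : groupType) (s : seq G) (x : G) : Prop :=
  forall H : G -> Prop,
    is_subgroup H -> (forall y, y \in s -> H y) -> H x.

Definition locally_finite (G : groupType) : Prop :=
  forall s : seq G, exists t : seq G,
    forall x, generated_subgroup s x -> x \in t.

End Groups.

(* The additive group of [group_ring R G] is that of the finitely supported
   functions [{malg R[G]}]. The library's product on [{malg R[K]}] is only
   available when [K] has no nontrivial units, so it is redone for groups. *)
Definition group_ring (R : pzRingType) (G : groupType) : Type := {malg R[G]}.

HB.instance Definition _ (R : pzRingType) (G : groupType) :=
  GRing.Zmodule.on (group_ring R G).

Section GroupRing.
Variables (R : pzRingType) (G : groupType).

Implicit Types (f g h : {malg R[G]}).

Definition gr_one : {malg R[G]} := << (1 : R) *g (1%g : G) >>.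

Definition gr_mul f g : {malg R[G]} :=
  \sum_(a <- msupp f) \sum_(b <- msupp g) << f@_a * g@_b *g (a * b)%g >>.

Lemma gr_mulw (d1 d2 : {fset G}) f g :
  msupp f `<=` d1 -> msupp g `<=` d2 ->
  gr_mul f g =
    \sum_(a <- d1) \sum_(b <- d2) << f@_a * g@_b *g (a * b)%g >>.
Proof.
move=> le_d1 le_d2; rewrite /gr_mul (big_fset_incl _ le_d1) /=.
  apply/eq_bigr=> k1 _; apply/big_fset_incl => // k _ /mcoeff_outdom ->.
  by rewrite mulr0 monalgU0.
move=> k _ /mcoeff_outdom fk.
by rewrite big1 => // k' _; rewrite fk mul0r monalgU0.
Qed.

Lemma gr_mul0 : left_zero 0 gr_mul.
Proof. by move=> g; rewrite /gr_mul msupp0 big_seq_fset0. Qed.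

Lemma gr_mulr0 : right_zero 0 gr_mul.
Proof.
by move=> g; rewrite /gr_mul big1 // => a _; rewrite msupp0 big_seq_fset0.
Qed.

Lemma gr_mulUU (c1 c2 : R) (a b : G) :
  gr_mul << c1 *g a >> << c2 *g b >> = << c1 * c2 *g (a * b)%g >>.
Proof. by rewrite (gr_mulw msuppU_le msuppU_le) !big_seq_fset1 !mcoeffUU. Qed.

Lemma gr_mulDl : left_distributive gr_mul +%R.
Proof.
move=> f g h.
rewrite (gr_mulw (msuppD_le f g) (fsubset_refl (msupp h))).
rewrite (gr_mulw (fsubsetUl (msupp f) (msupp g)) (fsubset_refl (msupp h))).
rewrite (gr_mulw (fsubsetUr (msupp f) (msupp g)) (fsubset_refl (msupp h))).
rewrite -big_split /=; apply/eq_bigr=> k1 _.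
rewrite -big_split /=; apply/eq_bigr=> k2 _.
by rewrite mcoeffD mulrDl monalgUD.
Qed.

Lemma gr_mulDr : right_distributive gr_mul +%R.
Proof.
move=> h f g.
rewrite (gr_mulw (fsubset_refl (msupp h)) (msuppD_le f g)).
rewrite (gr_mulw (fsubset_refl (msupp h)) (fsubsetUl (msupp f) (msupp g))).
rewrite (gr_mulw (fsubset_refl (msupp h)) (fsubsetUr (msupp f) (msupp g))).
rewrite -big_split /=; apply/eq_bigr=> k1 _.
rewrite -big_split /=; apply/eq_bigr=> k2 _.
by rewrite mcoeffD mulrDr monalgUD.
Qed.

Lemma gr_mul_suml (I : Type) (r : seq I) (F : I -> {malg R[G]}) g :
  gr_mul (\sum_(i <- r) F i) g = \sum_(i <- r) gr_mul (F i) g.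
Proof.
exact: (big_morph (gr_mul^~ g) (fun _ _ => gr_mulDl _ _ _) (gr_mul0 g)).
Qed.

Lemma gr_mul_sumr (I : Type) (r : seq I) (F : I -> {malg R[G]}) g :
  gr_mul g (\sum_(i <- r) F i) = \sum_(i <- r) gr_mul g (F i).
Proof.
exact: (big_morph (gr_mul g) (fun _ _ => gr_mulDr _ _ _) (gr_mulr0 g)).
Qed.

Lemma gr_mul1 : left_id gr_one gr_mul.
Proof.
move=> g; rewrite [in LHS](monalgE g) gr_mul_sumr [RHS]monalgE.
by apply/eq_bigr=> a _; rewrite gr_mulUU mul1r mul1g.
Qed.

Lemma gr_mulr1 : right_id gr_one gr_mul.
Proof.
move=> g; rewrite [in LHS](monalgE g) gr_mul_suml [RHS]monalgE.
by apply/eq_bigr=> a _; rewrite gr_mulUU mulr1 mulg1.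
Qed.

Lemma gr_mulA : associative gr_mul.
Proof.
move=> f g h; rewrite (monalgE f) (monalgE g) (monalgE h).
rewrite !gr_mul_suml; apply/eq_bigr=> a _.
rewrite [LHS]gr_mul_sumr [X in _ = gr_mul X _]gr_mul_sumr gr_mul_suml.
apply/eq_bigr=> b _.
by rewrite !gr_mul_sumr; apply/eq_bigr=> c _; rewrite !gr_mulUU mulrA mulgA.
Qed.

End GroupRing.

HB.instance Definition _ (R : pzRingType) (G : groupType) :=
  GRing.Zmodule_isPzRing.Build (group_ring R G)
    (@gr_mulA R G) (@gr_mul1 R G) (@gr_mulr1 R G)
    (@gr_mulDl R G) (@gr_mulDr R G).

(* Main.v *)
Require Import Defs.
From HB Require Import structures.
From mathcomp Require Import all_boot all_algebra all_field finmap monalg.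
From mathcomp Require Import boolp classical_sets.

(* A ring is called locally finite when finitely many elements always lie in a
   finite subring; its elements are then periodic, by the pigeonhole principle.
   Let L be the Levitzki radical of R. Since L = Nil(R), the periodic ring R/L
   satisfies x^(d+1) = x with d = d(x) > 0, so it is commutative by Jacobson's
   theorem, and a commutative ring of positive characteristic whose elements are
   integral is locally finite. Local finiteness lifts from R/L to R: let
   T be a set of representatives of the elements of a finite subring of R/L. The
   failure of T to be a subring is measured by a finite subset D of L. As L is
   locally nilpotent, the finite set TDT has only finitely many nonzero
   products; they span a finite additive group U that is stable under T, and
   T + U is a finite subring of R. Finally, an element of RG lies in
   BH for a finite subring B of R and a finite subgroup H of G, and BH is a
   finite subring of RG.

   Jacobson's theorem is reduced to division rings by dividing by an ideal
   maximal among those avoiding an idempotent power of a commutator. In a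
   division ring D with x^d = 1 for all x <> 0, let a be noncentral and let F be
   the finite field generated by a. As t^q - t splits over F, some c <> a in F
   and z <> 0 in D satisfy z a = c z. Then F[z] is a finite domain, which is
   noncommutative and contradicts Wedderburn's theorem. *)

Set Implicit Arguments.
Unset Strict Implicit.
Unset Printing Implicit Defensive.

Import GRing.Theory.
Local Open Scope ring_scope.

(** * Finite additive spans and finite subrings *)

Section AdditiveSpan.
Variables (V : zmodType) (W : seq V).

(** The minimality clause makes [U] the additive subgroup generated by [W] and serves as an
    induction principle. *)
Definition is_zspan (U : seq V) : Prop :=
  [/\ zmod_closed [in U], {subset W <= U} &
      forall P : {pred V}, zmod_closed P -> {subset W <= P} -> {subset U <= P}].

End AdditiveSpan.

Lemma zmod_closed_add (V : zmodType) (P : {pred V}) : zmod_closed P ->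
  {in P &, forall x y, x + y \in P}.
Proof. by case/GRing.zmod_closedD. Qed.

(** As [k] kills every element, adjoining [w] to a finite subgroup only takes the multiples of [w]
    by [i < k]. *)
Lemma zspan_exists (V : zmodType) (k : nat) (W : seq V) :
  (0 < k)%N -> (forall x : V, x *+ k = 0) -> exists U, is_zspan W U.
Proof.
move=> k_gt0 Vk; elim: W => [|w W [U [[U0 UB] WU Umin]]].
  exists [:: 0]; split=> // [|P [P0 _] _ x].
    by split=> [|x y]; rewrite !inE // => /eqP-> /eqP->; rewrite subr0.
  by rewrite inE => /eqP->.
exists [seq u + w *+ i | u <- U, i <- iota 0 k]; split.
- split=> [|_ _ /allpairsP[[u i] [/= Uu _ ->]] /allpairsP[[v j] [/= Uv _ ->]]].
    apply/allpairsP; exists (0, 0%N); rewrite mulr0n addr0 mem_iota /=.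
    by split; rewrite ?add0n.
  (* Modulo [k], the number [j * k.-1] is -j. *)
  apply/allpairsP; exists (u - v, ((i + j * k.-1) %% k)%N) => /=.
  rewrite mem_iota ltn_mod k_gt0; split=> //; first exact: UB.
  have modk m : w *+ (m %% k) = w *+ m.
    by rewrite {2}(divn_eq m k) mulrnDr mulrnA Vk add0r.
  have -> : w *+ ((i + j * k.-1) %% k) = w *+ i - w *+ j.
    apply: (canRL (subrK _)); rewrite opprK modk mulrnDr -addrA -mulrnDr.
    by rewrite addnC -mulnS prednK // mulrnA Vk addr0.
  by rewrite opprD addrACA.
- move=> x; rewrite inE => /predU1P[->|/WU Ux]; apply/allpairsP.
    (* For [k = 1] the coefficient 1 is out of range, but then [w] is 0. *)
    case: k k_gt0 Vk => [|[|k]] // _ Vk.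
      by exists (0, 0%N); rewrite mem_iota /= -[w]mulr1n Vk add0r.
    by exists (0, 1%N); rewrite mem_iota /= add0r.
  by exists (x, 0%N); rewrite mem_iota addr0.
move=> P Pz WP _ /allpairsP[[u i] [/= Uu _ ->]].
have Pw : w \in P by apply: WP; rewrite mem_head.
apply: (zmod_closed_add Pz).
  by apply: Umin => // x Wx; rewrite WP // inE Wx orbT.
elim: i => [|i IHi]; first by case: Pz.
by rewrite mulrS; apply: (zmod_closed_add Pz).
Qed.

Lemma zspan_ind (V V' : zmodType) (W U : seq V) (f : V -> V') (P : {pred V'}) :
  is_zspan W U -> {morph f : x y / x - y} -> zmod_closed P ->
  (forall w, w \in W -> f w \in P) -> forall u, u \in U -> f u \in P.
Proof.
move=> [_ _ Umin] fB [P0 PB] WP u /(Umin [preim f of P]); rewrite !inE; apply.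
  split=> [|x y Px Py]; rewrite inE; last by rewrite fB; apply: PB.
  by rewrite -(subrr 0) fB subrr.
by move=> w /WP Pw; rewrite inE.
Qed.

Lemma zspan_mulr_closed (A : pzRingType) (W U : seq A) : is_zspan W U ->
  (forall v w, v \in W -> w \in W -> v * w \in U) -> GRing.mulr_2closed [in U].
Proof.
move=> WU WW x y Ux Uy; have [Uz _ _] := WU.
apply: (zspan_ind WU (mulrBr x) Uz _ Uy) => w Ww.
by apply: (zspan_ind WU (fun a b => mulrBl w a b) Uz _ Ux) => v Wv; apply: WW.
Qed.

(* Finite subrings are given by their lists of elements. *)
Lemma finite_subring_periodic (A : pzRingType) (t : seq A) (x : A) :
  subring_closed [in t] -> x \in t ->
  exists m n, [/\ (0 < m)%N, (m < n)%N & x ^+ m = x ^+ n].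
Proof.
move=> [t1 _ tM] tx; pose s := [seq x ^+ i | i <- iota 1 (size t).+1].
have st : {subset s <= t}.
  by move=> _ /mapP[i _ ->]; elim: i => [//|i IHi]; rewrite exprS tM.
have : ~~ uniq s.
  by apply/negP => /uniq_leq_size/(_ st); rewrite size_map size_iota ltnn.
case/(uniqPn 0) => i [j []]; rewrite size_map size_iota => ij jt.
rewrite !(nth_map 0%N) ?size_iota ?nth_iota //; last exact: ltn_trans jt.
- by exists (1 + i)%N, (1 + j)%N.
- exact: ltn_trans jt.
Qed.

(** The last hypothesis moves powers of [x] to the right of [t], and x^n drops to x^m, so the
    products b x^i with i < n span a ring. Letting [c] differ from [b] covers an [x] that does not
    centralise [t]. *)
Lemma finite_subring_ext (A : pzRingType) (k : nat) (t : seq A) (x : A) m n :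
  (0 < k)%N -> k%:R = 0 :> A -> subring_closed [in t] ->
  (m < n)%N -> x ^+ m = x ^+ n ->
  (forall b, b \in t -> exists2 c, c \in t & x * b = c * x) ->
  exists u : seq A, [/\ subring_closed [in u], x \in u, {subset t <= u} &
    forall P : {pred A}, subring_closed P -> x \in P -> {subset t <= P} ->
      {subset u <= P}].
Proof.
move=> k_gt0 Ak [t1 tB tM] ltmn xmn xt.
have Ak' (y : A) : y *+ k = 0 by rewrite -mulr_natr Ak mulr0.
pose W := [seq b * x ^+ i | b <- t, i <- iota 0 n].
have [u Wu] := zspan_exists W k_gt0 Ak'; have [uz uW umin] := Wu.
have Wx i b : b \in t -> b * x ^+ i \in W.
  move=> tb; elim/ltn_ind: i => i IHi; have [ltin|leni] := ltnP i n.
    by apply/allpairsP; exists (b, i); rewrite mem_iota.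
  have -> : b * x ^+ i = b * x ^+ (m + (i - n)).
    by rewrite exprD xmn -exprD subnKC.
  by apply: IHi; rewrite -{2}(subnKC leni) ltn_add2r.
have u1 : 1 \in u by rewrite -[1]mulr1 -(expr0 x); apply/uW/Wx.
have xit i b : b \in t -> exists2 c, c \in t & x ^+ i * b = c * x ^+ i.
  move=> tb; elim: i => [|i [c tc IHi]].
    by exists b; rewrite // mul1r mulr1.
  have [d td xc] := xt c tc; exists d => //.
  by rewrite exprS -mulrA IHi mulrA xc -mulrA.
exists u; split.
- split=> //; first by case: uz.
  apply: (zspan_mulr_closed Wu) => v w /allpairsP[[b i] [/= tb _ ->]].
  move=> /allpairsP[[b' j] [/= tb' _ ->]]; have [c tc xib] := xit i b' tb'.
  by rewrite mulrA -(mulrA b) xib -!mulrA -exprD mulrA; apply/uW/Wx/tM.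
- by rewrite -[x]mul1r; apply/uW/(Wx 1%N).
- by move=> b tb; rewrite -[b]mulr1; apply/uW/(Wx 0%N).
move=> P [P1 PB PM] Px tP; apply: umin.
  by split=> //; rewrite -(subrr 1) PB.
move=> _ /allpairsP[[b i] [/= tb _ ->]]; apply: (PM); first exact: tP.
by elim: i => [//|i IHi]; rewrite exprS; apply: PM.
Qed.

Section FiniteSubring.
Variables (A : pzRingType) (t : seq A) (t_subring : subring_closed [in t]).

(** The closure proof is an argument of the type, so that the ring structure can be inferred from
    the type. *)
Definition subring_of of subring_closed [in t] := seq_sub t.
Local Notation T := (subring_of t_subring).
HB.instance Definition _ := SubFinite.on T.
HB.instance Definition _ :=
  GRing.SubChoice_isSubPzRing.Build A [in t] T t_subring.

Hypothesis (A_nz : 1 != 0 :> A).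
Hypothesis (A_dom : forall x y : A, x * y = 0 -> x = 0 \/ y = 0).

(** A finite domain is commutative by Wedderburn's little theorem, which enters through
    [FinDomainFieldType]. *)
Lemma finite_subring_finField :
  exists (F : finFieldType) (f : {rmorphism F -> A}),
    injective f /\ forall a, a \in t <-> exists x, f x = a.
Proof.
have T_nz : 1 != 0 :> T by [].
pose ncM := GRing.PzSemiRing_isNonZero.Build T T_nz.
pose ncT : finNzRingType := HB.pack T ncM.
pose uM := FinRing.isNzRing.Build ncT.
pose uT : finUnitRingType := HB.pack ncT uM.
have dom : GRing.integral_domain_axiom uT.
  move=> x y /(congr1 val); rewrite (rmorphM (val : {rmorphism T -> A})).
  by case/A_dom => xy0; apply/orP; [left|right]; apply/eqP/val_inj.
exists (FinDomainFieldType dom), (val : {rmorphism T -> A}).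
split=> [|a]; first exact: val_inj.
split=> [ta|[x <-]]; first by exists (Sub a ta).
exact: ssvalP.
Qed.
End FiniteSubring.

(** * Jacobson's theorem for division rings *)

Lemma finite_prime_subring (A : pzRingType) (k : nat) :
  (0 < k)%N -> k%:R = 0 :> A ->
  exists t : seq A, subring_closed [in t] /\
    forall P : {pred A}, subring_closed P -> {subset t <= P}.
Proof.
move=> k_gt0 Ak; have Ak' (y : A) : y *+ k = 0 by rewrite -mulr_natr Ak mulr0.
have [t tz] := zspan_exists [:: 1] k_gt0 Ak'; exists t.
have [[t0 tB] t1 tmin] := tz; rewrite /= in t1.
have t1' : 1 \in t by apply: t1; rewrite mem_head.
split; first split=> //.
  apply: (zspan_mulr_closed tz) => v w.
  by rewrite !inE => /eqP-> /eqP->; rewrite mulr1.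
move=> P [P1 PB _]; apply: tmin; first by split; rewrite // -(subrr 1) PB.
by move=> x; rewrite inE => /eqP->.
Qed.

Lemma comm_subring_closed (A : pzRingType) (x : A) :
  subring_closed [pred b | x * b == b * x].
Proof.
split=> [|b c|b c]; rewrite !inE ?mulr1 ?mul1r // => /eqP xb /eqP xc.
  by rewrite mulrBr mulrBl xb xc.
by rewrite mulrA xb -mulrA xc mulrA.
Qed.

(** The prime subring lies in the centraliser of [x], so [x] can be adjoined to it with [c = b]. *)
Lemma finite_subring_gen1 (A : pzRingType) (k m n : nat) (x : A) :
  (0 < k)%N -> k%:R = 0 :> A -> (m < n)%N -> x ^+ m = x ^+ n ->
  exists t : seq A, [/\ subring_closed [in t], x \in t &
    forall P : {pred A}, subring_closed P -> x \in P -> {subset t <= P}].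
Proof.
move=> k_gt0 Ak ltmn xmn; have [s [s_ring smin]] := finite_prime_subring k_gt0 Ak.
have [|t [t_ring tx _ tmin]] := finite_subring_ext k_gt0 Ak s_ring ltmn xmn.
  by move=> b sb; exists b => //; apply/eqP/(smin _ (comm_subring_closed x)).
by exists t; split=> // P Pr Px; apply: tmin => //; apply: smin.
Qed.

Section TwistedHorner.
Variables (F : fieldType) (A : pzRingType) (f : {rmorphism F -> A}) (a : A).
Implicit Types (p q : {poly F}) (y z : A).

(** This is [p] evaluated at the operator of right multiplication by [a], with coefficients acting
    by left multiplication, and applied to [y]. *)
Definition twisted_horner p y := \sum_(i < size p) f p`_i * y * a ^+ i.

Lemma twisted_hornerE N p y : (size p <= N)%N ->
  twisted_horner p y = \sum_(i < N) f p`_i * y * a ^+ i.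
Proof.
move=> leN; rewrite /twisted_horner.
rewrite (big_ord_widen _ (fun i => f p`_i * y * a ^+ i) leN).
rewrite big_mkcond; apply: eq_bigr => i _; case: ltnP => // lei.
by rewrite nth_default // rmorph0 !mul0r.
Qed.

Lemma twisted_hornerB p q y :
  twisted_horner (p - q) y = twisted_horner p y - twisted_horner q y.
Proof.
pose N := maxn (size p) (size q).
rewrite !(@twisted_hornerE N) ?leq_maxl ?leq_maxr ?(leq_trans (size_polyD _ _)) //.
  by rewrite -sumrB; apply: eq_bigr => i _; rewrite coefB rmorphB !mulrBl.
by rewrite size_polyN.
Qed.

Lemma twisted_hornerXn n y : twisted_horner 'X^n y = y * a ^+ n.
Proof.
rewrite /twisted_horner size_polyXn big_ord_recr /= coefXn eqxx rmorph1 mul1r.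
rewrite big1 ?add0r // => i _; rewrite coefXn ltn_eqF //.
by rewrite rmorph0 !mul0r.
Qed.

(** Left multiplications by [F] commute with each other and with right multiplication by [a], so
    products of polynomials act by composition. *)
Lemma twisted_horner_XsubC c p y :
  twisted_horner (('X - c%:P) * p) y = twisted_horner p (y * a - f c * y).
Proof.
have sz : (size (('X - c%:P) * p)%R <= (size p).+1)%N.
  by rewrite (leq_trans (size_polyMleq _ _)) // size_XsubC.
rewrite (twisted_hornerE _ sz) mulrBl /twisted_horner.
under eq_bigr do rewrite coefB coefXM coefCM rmorphB !mulrBl rmorphM.
under [RHS]eq_bigr do rewrite mulrBr mulrBl.
rewrite !sumrB big_ord_recl /= rmorph0 !mul0r add0r; congr (_ - _).
  by apply: eq_bigr => i _; rewrite /= exprS !mulrA.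
rewrite big_ord_recr /= nth_default // rmorph0 mulr0 !mul0r addr0.
by apply: eq_bigr => i _; rewrite !mulrA -!rmorphM (mulrC c).
Qed.

(** When the linear factors are applied to [y] one after another, the last nonzero value is the
    eigenvector [z]. *)
Lemma twisted_horner_root (s : seq F) y : y != 0 ->
  twisted_horner (\prod_(c <- s) ('X - c%:P)) y = 0 ->
  exists2 c, c \in s & exists2 z, z != 0 & z * a = f c * z.
Proof.
elim: s y => [|c s IHs] y y_nz.
  rewrite big_nil -(expr0 'X) twisted_hornerXn expr0 mulr1 => y0.
  by rewrite y0 eqxx in y_nz.
rewrite big_cons twisted_horner_XsubC.
have [/eqP|y'_nz] := eqVneq (y * a - f c * y) 0.
  by rewrite subr_eq0 => /eqP ya _; exists c; [rewrite mem_head|exists y].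
by case/(IHs _ y'_nz)=> d sd hd; exists d; rewrite // inE sd orbT.
Qed.
End TwistedHorner.

Lemma periodic_division_ring_comm (D : pzRingType) (k : nat) :
  (0 < k)%N -> k%:R = 0 :> D -> 1 != 0 :> D ->
  (forall x : D, x != 0 -> exists2 d, (0 < d)%N & x ^+ d = 1) ->
  forall x y : D, x * y = y * x.
Proof.
move=> k_gt0 Dk D_nz Dinv y a; apply/eqP/negP => /negP ya.
have Ddom (u v : D) : u * v = 0 -> u = 0 \/ v = 0.
  move=> uv; have [->|/Dinv[[|d] // _ ud]] := eqVneq u 0; first by left.
  by right; rewrite -[v]mul1r -ud exprSr -mulrA uv mulr0.
have a_nz : a != 0 by apply: contraNneq ya => ->; rewrite mulr0 mul0r.
have [d d_gt0 ad] := Dinv a a_nz.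
have a0d : a ^+ 0 = a ^+ d by rewrite ad.
have [B [B_ring Ba Bmin]] := finite_subring_gen1 k_gt0 Dk d_gt0 a0d.
have [F [f [f_inj fB]]] := finite_subring_finField B_ring D_nz Ddom.
have [a' fa] := (fB a).1 Ba.
pose s := [seq c <- index_enum F | c != a'].
(* The vector [y * a - a * y] is what the factor X - a' makes of [y]. The full product X^q - X kills
   [y] because a^q = a, so the other factors supply an eigenvalue different from [a']. *)
have [||c sc [z z_nz zc]] := @twisted_horner_root F D f a s (y * a - a * y).
- by rewrite subr_eq0.
- have -> : y * a - a * y = y * a - f a' * y by rewrite fa.
  have Xq : 'X^#|F| - 'X^1 = ('X - a'%:P) * \prod_(c <- s) ('X - c%:P).
    by rewrite expr1 finField_genPoly (bigD1 a') // big_filter.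
  rewrite -twisted_horner_XsubC -Xq twisted_hornerB !twisted_hornerXn.
  by rewrite -{1}fa -rmorphXn expf_card /= fa expr1 subrr.
(* The elements that [z] carries into [B z] form a subring. It contains [a], hence all of [B]. *)
have zB b : b \in B -> exists2 b', b' \in B & z * b = b' * z.
  pose P := [pred b | `[< exists2 b', b' \in B & z * b = b' * z >]].
  have [B1 BB BM] := B_ring.
  move=> Bb; apply/asboolP; apply: (Bmin P) Bb; last first.
    by apply/asboolP; exists (f c) => //; apply/fB; exists c.
  split; first by apply/asboolP; exists 1; rewrite // mulr1 mul1r.
    move=> u v /asboolP[u' Bu zu] /asboolP[v' Bv zv]; apply/asboolP.
    by exists (u' - v'); [apply: BB | rewrite mulrBr mulrBl zu zv].
  move=> u v /asboolP[u' Bu zu] /asboolP[v' Bv zv]; apply/asboolP.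
  by exists (u' * v'); [apply: BM | rewrite mulrA zu -mulrA zv mulrA].
have [e e_gt0 ze] := Dinv z z_nz.
have z0e : z ^+ 0 = z ^+ e by rewrite ze.
have [C [C_ring Cz BC _]] := finite_subring_ext k_gt0 Dk B_ring e_gt0 z0e zB.
have [K [g [_ gC]]] := finite_subring_finField C_ring D_nz Ddom.
have [[z' gz] [a1 ga]] := ((gC z).1 Cz, (gC a).1 (BC a Ba)).
(* In the field [K] the elements [z] and [a] commute, so c z = z a = a z. *)
have : (f c - a) * z = 0.
  by rewrite mulrBl -zc -gz -ga -!rmorphM (mulrC z') subrr.
case/Ddom => [/eqP|z0]; last by rewrite z0 eqxx in z_nz.
rewrite subr_eq0 -fa => /eqP/f_inj ca.
by move: sc; rewrite mem_filter ca eqxx.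
Qed.

(** * Quotients by two-sided ideals *)

Section IdealQuotient.
Local Open Scope quotient_scope.
Variables (R : pzRingType) (I : R -> Prop) (I_ideal : two_sided_ideal I).

Definition ideal_pred of two_sided_ideal I : {pred R} := [pred x | `[< I x >]].
Local Notation P := (ideal_pred I_ideal).

Fact ideal_pred_zmod_closed : zmod_closed P.
Proof.
have [I0 IB _ _] := I_ideal; rewrite /ideal_pred.
split=> [|x y]; rewrite !inE; first exact: I0.
exact: IB.
Qed.
HB.instance Definition _ := GRing.isZmodClosed.Build R P ideal_pred_zmod_closed.

Definition ideal_quotient : Type := @Quotient.quot R P.
HB.instance Definition _ := GRing.Zmodule.on ideal_quotient.
HB.instance Definition _ := EqQuotient.on ideal_quotient.
Local Notation Q := ideal_quotient.

Let pi (x : R) : Q := \pi_Q x.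

Let piK u : pi (repr u) = u. Proof. exact: reprK. Qed.

Fact ideal_quotient_eq x y : pi x = pi y <-> I (x - y).
Proof.
rewrite /pi; split=> [/eqP|Ixy]; last apply/eqP.
  by rewrite eqmodE => /asboolP.
by rewrite eqmodE; apply/asboolP.
Qed.

Let reprI (x : R) : I (repr (pi x) - x).
Proof. by apply/ideal_quotient_eq; rewrite /pi reprK. Qed.

Definition ideal_quotient_mul (u v : Q) : Q := pi (repr u * repr v).

Fact ideal_quotient_piM x y : pi (x * y) = ideal_quotient_mul (pi x) (pi y).
Proof.
apply/esym/ideal_quotient_eq.
have [I0 IB IMl IMr] := I_ideal.
(* With r the representative, the difference is r(x)(r(y) - y) + (r(x) - x)y. *)
rewrite -(subrKA (repr (pi x) * y)) -mulrBr -mulrBl -[X in _ + X]opprK.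
apply: (IB); first exact/IMl/reprI.
by rewrite -sub0r; apply: IB => //; apply/IMr/reprI.
Qed.

Fact ideal_quotient_piB x y : pi (x - y) = pi x - pi y.
Proof. by rewrite /pi !piE. Qed.

Fact ideal_quotient_piD x y : pi (x + y) = pi x + pi y.
Proof. by rewrite /pi !piE. Qed.

Fact ideal_quotient_mulA : associative ideal_quotient_mul.
Proof.
move=> u v w; rewrite -(piK u) -(piK v) -(piK w).
by rewrite -!ideal_quotient_piM mulrA.
Qed.

Fact ideal_quotient_mul1 : left_id (pi 1) ideal_quotient_mul.
Proof. by move=> u; rewrite -(piK u) -ideal_quotient_piM mul1r. Qed.

Fact ideal_quotient_mulr1 : right_id (pi 1) ideal_quotient_mul.
Proof. by move=> u; rewrite -(piK u) -ideal_quotient_piM mulr1. Qed.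

Fact ideal_quotient_mulDl : left_distributive ideal_quotient_mul +%R.
Proof.
move=> u v w; rewrite -(piK u) -(piK v) -(piK w).
by rewrite -!(ideal_quotient_piM, ideal_quotient_piD) mulrDl.
Qed.

Fact ideal_quotient_mulDr : right_distributive ideal_quotient_mul +%R.
Proof.
move=> u v w; rewrite -(piK u) -(piK v) -(piK w).
by rewrite -!(ideal_quotient_piM, ideal_quotient_piD) mulrDr.
Qed.

HB.instance Definition _ := GRing.Zmodule_isPzRing.Build Q
  ideal_quotient_mulA ideal_quotient_mul1 ideal_quotient_mulr1
  ideal_quotient_mulDl ideal_quotient_mulDr.

Fact ideal_quotient_pi_zmod_morphism : zmod_morphism pi.
Proof. exact: ideal_quotient_piB. Qed.
Fact ideal_quotient_pi_monoid_morphism : monoid_morphism pi.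
Proof. by split=> // x y; apply: ideal_quotient_piM. Qed.
HB.instance Definition _ := GRing.isZmodMorphism.Build R Q pi
  ideal_quotient_pi_zmod_morphism.
HB.instance Definition _ := GRing.isMonoidMorphism.Build R Q pi
  ideal_quotient_pi_monoid_morphism.

(** Later proofs see the quotient only through a surjective morphism with kernel [I]. *)
Lemma ideal_quotient_exists :
  exists (A : pzRingType) (f : {rmorphism R -> A}),
    (forall a, exists x, f x = a) /\ (forall x, f x = 0 <-> I x).
Proof.
exists Q, pi; split=> [a|x]; first by exists (repr a); apply: reprK.
by rewrite -(rmorph0 pi) ideal_quotient_eq subr0.
Qed.

End IdealQuotient.

(** * Jacobson's theorem *)

Lemma maximal_ideal_avoiding (A : pzRingType) (e : A) : e != 0 ->
  exists I : A -> Prop, [/\ two_sided_ideal I, ~ I e &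
    forall J : A -> Prop, two_sided_ideal J -> (forall x, I x -> J x) ->
      ~ J e -> forall x, J x -> I x].
Proof.
move=> e_nz.
(* The empty set is admitted so that the union of the empty chain qualifies. *)
pose S (I : set A) := [/\ forall x y, I x -> I y -> I (x - y),
  forall a x, I x -> I (a * x), forall a x, I x -> I (x * a) & ~ I e].
have [F FS Ftot|I [[IB IMl IMr Ie] Imax]] := @Zorn_bigcup A S.
  split=> [x y [J FJ Jx] [K FK Ky]|a x [J FJ Jx]|a x [J FJ Jx]|[J FJ Je]].
  - have [JB _ _ _] := FS _ FJ; have [KB _ _ _] := FS _ FK.
    case: (Ftot _ _ FJ FK) => [JK|KJ]; [exists K|exists J] => //.
      exact/KB/Ky/JK.
    exact/JB/KJ.
  - by have [_ JM _ _] := FS _ FJ; exists J => //; apply: JM.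
  - by have [_ _ JM _] := FS _ FJ; exists J => //; apply: JM.
  - by have [_ _ _ nJe] := FS _ FJ.
(* An empty [I] would not be maximal, since the zero ideal also avoids [e]. *)
have I0 : I 0.
  have [[x Ix]|I_empty] := pselect (exists x, I x).
    by rewrite -(subrr x); apply: IB.
  case: (Imax (fun x => x = 0)); first split.
  - by move=> x Ix; case: I_empty; exists x.
  - by move=> /(_ 0 erefl) I0; apply: I_empty; exists 0.
  split=> [x y -> ->|a x ->|a x ->|/eqP].
  - exact: subrr.
  - exact: mulr0.
  - exact: mul0r.
  - by rewrite (negPf e_nz).
exists I; split=> // J [J0 JB JMl JMr] IJ nJe x Jx.
apply: contrapT => nIx; case: (Imax J); last by split.
by split=> // JI; apply/nIx/JI.
Qed.

Section PotentRing.
Variables (A : pzRingType).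
Hypothesis A_pot : forall x : A, exists2 d, (0 < d)%N & x ^+ d.+1 = x.

(** Apply potency to the element 2: the equation 2^(d+1) = 2 bounds the characteristic. *)
Lemma potent_char : exists2 k, (0 < k)%N & k%:R = 0 :> A.
Proof.
have [d d_gt0 d2] := A_pot 2%:R; exists (2 ^ d.+1 - 2)%N.
  by rewrite subn_gt0 -[X in (X < _)%N]expn1 ltn_exp2l.
by rewrite natrB ?natrX ?d2 ?subrr // -[X in (X <= _)%N]expn1 leq_exp2l.
Qed.

Lemma potent_reduced (x : A) : x * x = 0 -> x = 0.
Proof.
by have [[|d] // _ xd] := A_pot x => x2; rewrite -xd !exprS mulrA x2 mul0r.
Qed.

Lemma potent_idempotent (x : A) d : (0 < d)%N -> x ^+ d.+1 = x ->
  x ^+ d * x ^+ d = x ^+ d.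
Proof.
by case: d => // d _ xd; rewrite [X in _ * X]exprS mulrA -exprSr xd -exprS.
Qed.

(** Both ur - uru and ru - uru have square zero, hence vanish. *)
Lemma potent_idempotent_central (u r : A) : u * u = u -> u * r = r * u.
Proof.
move=> uu; transitivity (u * r * u).
  apply/eqP; rewrite -subr_eq0; apply/eqP/potent_reduced.
  by rewrite mulrBr !mulrBl !mulrA -!(mulrA _ u u) uu !subrr.
apply/esym/eqP; rewrite -subr_eq0; apply/eqP/potent_reduced.
by rewrite mulrBr !mulrBl !mulrA -!(mulrA _ u u) uu !subrr.
Qed.

End PotentRing.

Theorem jacobson_comm (A : pzRingType) :
  (forall x : A, exists2 d, (0 < d)%N & x ^+ d.+1 = x) ->
  forall x y : A, x * y = y * x.
Proof.
move=> A_pot x y; apply/eqP/negP => /negP; rewrite -subr_eq0.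
set c := x * y - y * x => c_nz; have [d d_gt0 cd] := A_pot c.
have e_nz : c ^+ d != 0.
  by apply: contraNneq c_nz => cd0; rewrite -cd exprS cd0 mulr0.
set e := c ^+ d in e_nz; have ee : e * e = e by apply: potent_idempotent.
have [I [I_ideal nIe Imax]] := maximal_ideal_avoiding e_nz.
have [D [f [f_surj f_ker]]] := ideal_quotient_exists I_ideal.
have D_pot (u : D) : exists2 m, (0 < m)%N & u ^+ m.+1 = u.
  have [v <-] := f_surj u; have [m m_gt0 vm] := A_pot v.
  by exists m; rewrite // -rmorphXn vm.
have fe_nz : f e != 0 by apply/eqP => /f_ker.
(* As [u] is central, the r with u f(r) = f(r) form an ideal containing [I]. If it avoided [e],
   maximality would put it inside [I]; a preimage of [u] lies in it, so [u] would be 0. *)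
have fe_min (u : D) : u * u = u -> u != 0 -> u * f e = f e.
  move=> uu u_nz; have uC r := potent_idempotent_central D_pot r uu.
  apply: contrapT => ufe; have [v fv] := f_surj u.
  case/eqP: u_nz; rewrite -fv; apply/f_ker/(Imax (fun r => u * f r = f r)) => //.
  - split=> [|r s|a r|a r].
    + by rewrite rmorph0 mulr0.
    + by move=> ur us; rewrite rmorphB mulrBr ur us.
    + by move=> ur; rewrite rmorphM mulrA uC -mulrA ur.
    + by move=> ur; rewrite rmorphM mulrA ur.
  - by move=> r /f_ker->; rewrite mulr0.
  - by rewrite fv.
(* A nonzero idempotent 1 - f(e) would fix f(e) by [fe_min], yet it annihilates f(e). *)
have fe1 : f e = 1.
  apply/eqP; rewrite eq_sym -subr_eq0; apply/negPn/negP => fe'_nz.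
  case/eqP: fe_nz; rewrite -(fe_min (1 - f e)) //.
    by rewrite mulrBl mul1r -rmorphM ee subrr.
  by rewrite mulrBl mul1r mulrBr mulr1 -rmorphM ee subrr subr0.
have [k k_gt0 Dk] := potent_char D_pot.
have D_comm : forall u v : D, u * v = v * u.
  apply: (periodic_division_ring_comm k_gt0 Dk); first by rewrite -fe1.
  (* The power u^m is a nonzero idempotent, so [fe_min] and [fe1] make it 1. *)
  move=> u u_nz; have [m m_gt0 um] := D_pot u; exists m => //.
  rewrite -[LHS]mulr1 -fe1 fe_min //; first exact: potent_idempotent.
  by apply: contraNneq u_nz => um0; rewrite -um exprS um0 mulr0.
case/eqP: fe_nz; rewrite rmorphXn rmorphB !rmorphM D_comm subrr.
by rewrite expr0n eqn0Ngt d_gt0.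
Qed.

(** * Locally finite rings *)

Definition locally_finite_ring (A : pzRingType) : Prop :=
  forall s : seq A, exists t : seq A, subring_closed [in t] /\ {subset s <= t}.

(** The elements of [s] are adjoined one at a time to the prime subring; each commutes with what is
    already built by Jacobson's theorem. *)
Lemma potent_locally_finite (A : pzRingType) :
  (forall x : A, exists2 d, (0 < d)%N & x ^+ d.+1 = x) -> locally_finite_ring A.
Proof.
move=> A_pot; have [k k_gt0 Ak] := potent_char A_pot.
elim=> [|x s [t [t_ring st]]].
  by have [t [t_ring _]] := finite_prime_subring k_gt0 Ak; exists t.
have [d d_gt0 xd] := A_pot x; rewrite -[RHS]expr1 in xd.
have [|u [u_ring ux tu _]] :=
    finite_subring_ext k_gt0 Ak t_ring (d_gt0 : (1 < d.+1)%N) (esym xd).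
  by move=> b tb; exists b => //; apply: jacobson_comm.
by exists u; split=> // y; rewrite inE => /predU1P[->//|/st/tu].
Qed.

Lemma lists_of_size (T : eqType) (s : seq T) (n : nat) :
  exists L : seq (seq T), forall l, l \in L <-> size l = n /\ {subset l <= s}.
Proof.
elim: n => [|n [L Ll]].
  by exists [:: [::]] => l; rewrite inE; split=> [/eqP->|[/size0nil->]].
exists [seq a :: l | a <- s, l <- L] => l; split.
  case/allpairsP=> -[a l'] [/= sa /Ll[sz l's] ->]; rewrite /= sz; split=> // b.
  by rewrite inE => /predU1P[->//|/l's].
case: l => [|a l] [] // [sz] als; apply/allpairsP; exists (a, l) => /=.
rewrite als ?mem_head //; split=> //; apply/Ll; split=> // b lb.
by rewrite als // inE lb orbT.
Qed.

(** The empty word is excluded because stability of the span of words will be proved by absorbing a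
    multiplier into the first or last letter. *)
Lemma finite_words (A : pzRingType) (s : seq A) (N : nat) :
  exists W : seq A, forall x, x \in W <->
    exists2 l, [/\ (0 < size l)%N, (size l < N)%N & {subset l <= s}]
             & x = \prod_(a <- l) a.
Proof.
elim: N => [|N [W Wl]]; first by exists [::] => x; split=> // -[l []].
have [L Ll] := lists_of_size s N.
exists (W ++ [seq \prod_(a <- l) a | l <- L & (0 < size l)%N]) => x.
rewrite mem_cat; split.
  case/orP=> [/Wl[l [l_gt0 ltlN ls] xl]|/mapP[l]].
    by exists l => //; split=> //; apply: ltnW.
  by rewrite mem_filter => /andP[l_gt0 /Ll[<- ls]] ->; exists l => //; split.
case=> l [l_gt0 + ls xl]; rewrite ltnS leq_eqVlt => /orP[/eqP sz|ltlN].
  apply/orP; right; apply/mapP; exists l; rewrite // mem_filter l_gt0.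
  exact/Ll.
by apply/orP; left; apply/Wl; exists l.
Qed.

(** Long words in [E] vanish, so the nonempty words have a finite span. It is stable since c(c1 d
    c2), with c c1 = c3 + d', is the letter c3 d c2 plus the two-letter word d' (d c2); the right
    side is symmetric. *)
Lemma locally_nilpotent_stable_span (R : pzRingType) (k : nat) (I : R -> Prop)
    (G D : seq R) :
  (0 < k)%N -> k%:R = 0 :> R -> two_sided_ideal I -> locally_nilpotent I ->
  1 \in G -> (forall d, d \in D -> I d) ->
  (forall c c', c \in G -> c' \in G ->
     exists c'' d, [/\ c'' \in G, d \in D & c * c' = c'' + d]) ->
  exists U : seq R,
    [/\ zmod_closed [in U], GRing.mulr_2closed [in U], {subset D <= U},
        forall c u, c \in G -> u \in U -> c * u \in U &
        forall c u, c \in G -> u \in U -> u * c \in U].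
Proof.
move=> k_gt0 Rk [_ _ IMl IMr] I_nil G1 DI GM.
have Rk' (y : R) : y *+ k = 0 by rewrite -mulr_natr Rk mulr0.
(* With factors from [G] on both sides of each element of [D], the words in [E]
   have a span that is stable under multiplication by [G]. *)
pose E := [seq c * d | c <- G, d <- [seq d * c | d <- D, c <- G]].
have EP x : x \in E <->
    exists c d c', [/\ c \in G, d \in D, c' \in G & x = c * d * c'].
  split=> [/allpairsP[[c y] [/= Gc /allpairsP[[d c'] [/= Dd Gc' ->]] ->]]|].
    by exists c, d, c'; rewrite mulrA.
  case=> c [d [c' [Gc Dd Gc' ->]]]; apply/allpairsP; exists (c, d * c').
  by rewrite mulrA; split=> //; apply/allpairsP; exists (d, c').
have EI x : x \in E -> I x.
  by case/EP=> c [d [c' [_ /DI Id _ ->]]]; apply/IMr/IMl.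
have [N N_gt0 EN] := I_nil E EI.
have [W Wl] := finite_words E N.
have [U WU] := zspan_exists W k_gt0 Rk'; have [Uz subWU _] := WU.
have UD := zmod_closed_add Uz; have [U0 UB] := Uz.
have Uprod l : (0 < size l)%N -> {subset l <= E} -> \prod_(a <- l) a \in U.
  move=> l_gt0 lE; have [ltlN|leNl] := ltnP (size l) N.
    by apply/subWU/Wl; exists l.
  rewrite -(cat_take_drop N l) big_cat /= EN ?mul0r ?size_takel //.
  by move=> a /mem_take/lE.
have EU x : x \in E -> x \in U.
  move=> Ex; have -> : x = \prod_(a <- [:: x]) a by rewrite big_seq1.
  by apply: Uprod => // y; rewrite inE => /eqP->.
have DE : {subset D <= E}.
  by move=> d Dd; apply/EP; exists 1, d, 1; rewrite mul1r mulr1.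
have UM : GRing.mulr_2closed [in U].
  apply: (zspan_mulr_closed WU) => v w.
  move=> /Wl[l [l_gt0 _ lE] ->] /Wl[l' [_ _ lE'] ->].
  rewrite -big_cat; apply: Uprod; first by rewrite size_cat addn_gt0 l_gt0.
  by move=> a; rewrite mem_cat => /orP[/lE|/lE'].
have GE c x : c \in G -> x \in E -> c * x \in U.
  move=> Gc /EP[c1 [d [c2 [Gc1 Dd Gc2 ->]]]].
  have [c3 [d' [Gc3 Dd' cc1]]] := GM c c1 Gc Gc1.
  rewrite !mulrA cc1 !mulrDl -!mulrA; apply: UD.
    by apply/EU/EP; exists c3, d, c2; rewrite !mulrA.
  apply: UM; first exact/EU/DE.
  by apply/EU/EP; exists 1, d, c2; rewrite mul1r.
have EG c x : c \in G -> x \in E -> x * c \in U.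
  move=> Gc /EP[c1 [d [c2 [Gc1 Dd Gc2 ->]]]].
  have [c3 [d' [Gc3 Dd' cc2]]] := GM c2 c Gc2 Gc.
  rewrite -!mulrA cc2 !mulrDr !mulrA; apply: UD.
    by apply/EU/EP; exists c1, d, c3.
  apply: UM; last exact/EU/DE.
  by apply/EU/EP; exists c1, d, 1; rewrite mulr1.
have GU c u : c \in G -> u \in U -> c * u \in U.
  move=> Gc Uu; apply: (zspan_ind WU (mulrBr c) Uz _ Uu) => w.
  case/Wl=> -[|x l] [] // _ _ lE ->; rewrite big_cons mulrA.
  have Ucx : c * x \in U by apply: GE; rewrite ?lE ?mem_head.
  case: l lE => [|y l] lE; first by rewrite big_nil mulr1.
  by apply: UM => //; apply: Uprod => // z lz; apply: lE; rewrite inE lz orbT.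
have UG c u : c \in G -> u \in U -> u * c \in U.
  move=> Gc Uu; apply: (zspan_ind WU (fun a b => mulrBl c a b) Uz _ Uu) => w.
  case/Wl=> l []; case/lastP: l => // l x _ _ lE ->.
  rewrite -cats1 big_cat big_seq1 -mulrA.
  have Uxc : x * c \in U by apply: EG; rewrite ?lE ?mem_rcons ?mem_head.
  case: l lE => [|y l] lE; first by rewrite big_nil mul1r.
  apply: UM => //; apply: Uprod => // z lz; apply: lE.
  by rewrite mem_rcons inE lz orbT.
by exists U; split=> // d /DE/EU.
Qed.

Lemma locally_finite_lift (R A : pzRingType) (f : {rmorphism R -> A}) (k : nat) :
  (0 < k)%N -> k%:R = 0 :> R -> (forall a, exists x, f x = a) ->
  locally_nilpotent (fun x => f x = 0) -> locally_finite_ring A ->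
  locally_finite_ring R.
Proof.
move=> k_gt0 Rk f_surj f_nil A_lf s.
have [g gK] := choice f_surj.
have [B [[B1 BB BM] sB]] := A_lf (map f s).
(* The representative [g 1] may differ from 1, so 1 is added. *)
pose G := 1 :: map g B.
(* [D] collects the defects of the section [g] for 1, for the elements of [s], for differences and
   for products. The entry 0 is the defect of products with the added factor 1. *)
pose D := 0 :: 1 - g 1 :: [seq x - g (f x) | x <- s]
  ++ [seq g a - g b - g (a - b) | a <- B, b <- B]
  ++ [seq g a * g b - g (a * b) | a <- B, b <- B].
have split_diff (u v : R) : u = v + (u - v) by rewrite addrC subrK.
have f_ideal : two_sided_ideal (fun x => f x = 0).
  split=> [|x y fx fy|a x fx|a x fx]; first exact: rmorph0.
  - by rewrite rmorphB fx fy subrr.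
  - by rewrite rmorphM fx mulr0.
  - by rewrite rmorphM fx mul0r.
have Dker x : x \in D -> f x = 0.
  rewrite /D !(inE, mem_cat) => /orP[/eqP->|]; first by rewrite rmorph0.
  case/orP=> [/eqP->|]; first by rewrite rmorphB gK rmorph1 subrr.
  case/or3P=> [/mapP[y _ ->]|/allpairsP[[a b] [_ _ ->]]|].
  - by rewrite rmorphB gK subrr.
  - by rewrite !rmorphB !gK subrr.
  - by case/allpairsP=> -[a b] [_ _ ->]; rewrite rmorphB rmorphM !gK subrr.
have D0 : 0 \in D by rewrite mem_head.
have GG a : a \in B -> g a \in G by move=> Ba; rewrite inE map_f ?orbT.
have DB a b : a \in B -> b \in B -> g a - g b - g (a - b) \in D.
  move=> Ba Bb; rewrite !inE !mem_cat; do 3![apply/orP; right].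
  by apply/orP; left; apply: (allpairs_f (fun a b => g a - g b - g (a - b))).
have DM a b : a \in B -> b \in B -> g a * g b - g (a * b) \in D.
  move=> Ba Bb; rewrite !inE !mem_cat; do 4![apply/orP; right].
  exact: (allpairs_f (fun a b => g a * g b - g (a * b))).
have GM c c' : c \in G -> c' \in G ->
    exists c'' d, [/\ c'' \in G, d \in D & c * c' = c'' + d].
  rewrite inE => /predU1P[-> Gc'|/mapP[a Ba ->]].
    by exists c', 0; rewrite mul1r addr0.
  rewrite inE => /predU1P[->|/mapP[b Bb ->]].
    by exists (g a), 0; rewrite mulr1 addr0 D0 GG.
  exists (g (a * b)), (g a * g b - g (a * b)).
  split; [exact/GG/BM | | exact: split_diff].
  exact: DM.
have [U [Uz UM DU GU UG]] :=
  locally_nilpotent_stable_span k_gt0 Rk f_ideal f_nil (mem_head _ _) Dker GM.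
have [[U0 UB] UD] := (Uz, zmod_closed_add Uz).
(* In each verification below, the component in [U] absorbs the corresponding defect. *)
exists [seq g a + u | a <- B, u <- U]; split; first split.
- apply/allpairsP; exists (1, 1 - g 1); split=> //=.
  by apply: DU; rewrite !inE eqxx orbT.
- move=> _ _ /allpairsP[[a u] [/= Ba Uu ->]] /allpairsP[[b v] [/= Bb Uv ->]].
  apply/allpairsP; exists (a - b, (g a - g b - g (a - b)) + (u - v)) => /=.
  split; [exact: BB | apply: (UD) | by rewrite addrA -split_diff opprD addrACA].
    exact/DU/DB.
  exact: UB.
- move=> _ _ /allpairsP[[a u] [/= Ba Uu ->]] /allpairsP[[b v] [/= Bb Uv ->]].
  apply/allpairsP.
  exists (a * b, (g a * g b - g (a * b)) + (g a * v + (u * g b + u * v))) => /=.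
  split; [exact: BM | apply: (UD) |]; last first.
  - by rewrite addrA -split_diff mulrDl !mulrDr !addrA.
  - by apply: (UD); [apply/GU/Uv/GG | apply: (UD); [apply/UG/Uu/GG | apply: UM]].
  - exact/DU/DM.
move=> x sx; apply/allpairsP; exists (f x, x - g (f x)).
split=> //=; first by apply/sB/map_f.
by apply: DU; rewrite !inE !mem_cat (map_f (fun y => y - g (f y))) ?orbT.
Qed.

(** * Periodic rings and group rings *)

Lemma periodic_lt (R : pzRingType) (x : R) : periodic R ->
  exists m n, [/\ (0 < m)%N, (m < n)%N & x ^+ m = x ^+ n].
Proof.
case/(_ x)=> m [n [m_gt0 n_gt0 /eqP neq_mn xmn]].
by case: (ltngtP m n) neq_mn => // ltmn _; [exists m, n | exists n, m].
Qed.

(** Periodicity of the element 2 gives 2^m = 2^n in [R]. *)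
Lemma periodic_char (R : pzRingType) : periodic R ->
  exists2 k, (0 < k)%N & k%:R = 0 :> R.
Proof.
case/(periodic_lt 2%:R)=> m [n [_ ltmn]] mn2; exists (2 ^ n - 2 ^ m)%N.
  by rewrite subn_gt0 ltn_exp2l.
have le_mn : (2 ^ m <= 2 ^ n)%N by rewrite leq_exp2l // ltnW.
by rewrite (natrB _ le_mn) !natrX mn2 subrr.
Qed.

(** With d = n - m, the power (x^(d+1) - x)^m equals x^m (x^d - 1)^m, and x^m (x^d - 1) = x^n - x^m
    = 0. *)
Lemma periodic_potent_mod_nil (R : pzRingType) (x : R) : periodic R ->
  exists2 d, (0 < d)%N & nilpotent_elt (x ^+ d.+1 - x).
Proof.
case/(periodic_lt x)=> m [n [m_gt0 ltmn xmn]].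
exists (n - m)%N; first by rewrite subn_gt0.
exists m; rewrite exprS -[X in _ - X]mulr1 -mulrBr exprMn_comm; last first.
  by apply: commrB; [apply/commrX/commr_refl | apply: commr1].
rewrite -(prednK m_gt0) [X in _ * X]exprS mulrA prednK // mulrBr mulr1.
by rewrite -exprD subnKC ?(ltnW ltmn) // xmn subrr mul0r.
Qed.

Lemma weakly_2primal_periodic_locally_finite (R : pzRingType) :
  weakly_2primal R -> periodic R -> locally_finite_ring R.
Proof.
move=> [L [[L_ideal L_nil _] nilL]] R_per.
have [k k_gt0 Rk] := periodic_char R_per.
have [A [f [f_surj f_ker]]] := ideal_quotient_exists L_ideal.
apply: (locally_finite_lift k_gt0 Rk f_surj).
  by move=> s sker; apply: L_nil => x /sker/f_ker.
apply: potent_locally_finite => a; have [x <-] := f_surj a.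
have [d d_gt0 /nilL/f_ker/eqP] := periodic_potent_mod_nil x R_per.
by rewrite rmorphB subr_eq0 rmorphXn => /eqP fx; exists d.
Qed.

Lemma locally_finite_subgroup (G : groupType) (s : seq G) : locally_finite G ->
  exists H : seq G, [/\ (1%g : G) \in H,
    {in H &, forall x y, (x * y)%g \in H} & {subset s <= H}].
Proof.
(* The list [t] may exceed the generated subgroup, so it is filtered. *)
case/(_ s)=> t st; exists [seq x <- t | `[< generated_subgroup s x >]].
have HP x : x \in [seq x <- t | `[< generated_subgroup s x >]] <->
    generated_subgroup s x.
  rewrite mem_filter; split=> [/andP[/asboolP]//|sx].
  by rewrite st // andbT; apply/asboolP.
split=> [|x y /HP sx /HP sy|x sx]; apply/HP => H.
- by case.
- by move=> Hgrp sH; have [_ HM _] := Hgrp; apply: HM; [apply: sx | apply: sy].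
- by move=> _; apply.
Qed.

Theorem theorem1p2 (R : pzRingType) (G : groupType)
    (R_weakly_2primal : weakly_2primal R) (R_periodic : periodic R)
    (G_locally_finite : locally_finite G) :
  periodic (group_ring R G).
Proof.
move=> a; have [k k_gt0 Rk] := periodic_char R_periodic.
have [H [H1 HM aH]] :=
  locally_finite_subgroup (msupp a : seq G) G_locally_finite.
have [B [[B1 BB BM] aB]] := weakly_2primal_periodic_locally_finite
  R_weakly_2primal R_periodic [seq mcoeff g a | g <- (msupp a : seq G)].
have RGk (x : group_ring R G) : x *+ k = 0.
  apply/malgP => g; rewrite mcoeffMn mcoeff0.
  by rewrite -mulr_natr Rk mulr0.
(* The monomials with coefficient in [B] and group element in [H] are closed under products, so
   their additive span is the finite subring BH. *)
pose W : seq (group_ring R G) :=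
  [seq (<< b *g h >> : {malg R[G]}) | b <- B, h <- H].
have [U WU] := zspan_exists W k_gt0 RGk; have [Uz subWU _] := WU.
have UW b h : b \in B -> h \in H -> (<< b *g h >> : group_ring R G) \in U.
  by move=> Bb Hh; apply/subWU/allpairsP; exists (b, h).
have U_ring : subring_closed [in U].
  split; [exact: UW | by case: Uz | apply: (zspan_mulr_closed WU)].
  move=> v w /allpairsP[[b g] [/= Bb Hg ->]] /allpairsP[[c h] [/= Bc Hh ->]].
  rewrite [_ * _](gr_mulUU b c g h); apply: UW; [exact: BM | exact: HM].
have Ua : a \in U.
  rewrite (monalgE a) big_seq.
  elim/big_rec: _ => [|g x ag Ux]; first by case: Uz.
  apply: (zmod_closed_add Uz) => //; apply: UW; [apply: aB | exact: aH].
  exact: (map_f (fun g => mcoeff g a)).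
have [m [n [m_gt0 ltmn amn]]] := finite_subring_periodic U_ring Ua.
exists m, n; split=> //; first exact: ltn_trans ltmn.
by move=> eq_mn; rewrite eq_mn ltnn in ltmn.
Qed.
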